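(* Let $d\ge 1$ be an integer and let ${\cal A}^{\star}_d\subset\mathbb{Z}^2$ be an optimal tristance anticode of diameter $d$ in the infinity graph ${\cal G}^{\star}_2$. Then $$|{\cal A}^{\star}_d| = \left\lceil \frac{4d^2+8d+2}{7}\right\rceil .$$ Moreover, up to rotation by an angle of $\pi/2$ and translation, ${\cal A}^{\star}_d = {\mathscr O}(a,b,c_0,c_1,c_2,c_3)$ with $a=b$, $c_0=c_2$, $c_1=c_3$, where, depending on $r=d\bmod 7$: $r=0$: $a=\tfrac{6d}{7}$, $c_0=\tfrac{2d}{7}$, $c_1=\tfrac{2d}{7}$; $r=1$: $a=\tfrac{6d+1}{7}$, $c_0=\tfrac{2d-2}{7}$, $c_1=\tfrac{2d+5}{7}$; $r=2$: $a=\tfrac{6d+2}{7}$, $c_0=\tfrac{2d+3}{7}$, $c_1=\tfrac{2d+3}{7}$; $r=3$: $a=\tfrac{6d-4}{7}$, $c_0=\tfrac{2d-6}{7}$, $c_1=\tfrac{2d-6}{7}$; $r=4$: $a=\tfrac{6d-3}{7}$, $c_0=\tfrac{2d-8}{7}$, $c_1=\tfrac{2d-1}{7}$; $r=5$: $a=\tfrac{6d-2}{7}$, $c_0=\tfrac{2d-3}{7}$, $c_1=\tfrac{2d-3}{7}$; $r=6$: $a=\tfrac{6d-1}{7}$, $c_0=\tfrac{2d-5}{7}$, $c_1=\tfrac{2d+2}{7}$.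
   Context: The infinity graph ${\cal G}^{\star}_2$ has vertex set $\mathbb{Z}^2$, with $(x,y)$ and $(x',y')$ adjacent iff $\max\{|x-x'|,|y-y'|\}=1$. For $z_1,z_2,z_3\in\mathbb{Z}^2$, the tristance $d^{\star}_3(z_1,z_2,z_3)$ is the minimum number of edges of a tree in ${\cal G}^{\star}_2$ (possibly using additional vertices) containing $z_1,z_2,z_3$. A set ${\cal A}\subset\mathbb{Z}^2$ is a tristance anticode of diameter $d$ in ${\cal G}^{\star}_2$ if $d^{\star}_3(z_1,z_2,z_3)\le d$ for all $z_1,z_2,z_3\in{\cal A}$; it is optimal if it has largest possible cardinality among such anticodes. For integers $a,b,c_0,c_1,c_2,c_3$, ${\mathscr O}(a,b,c_0,c_1,c_2,c_3)$ denotes the set of $(x,y)\in\mathbb{Z}^2$ with $0\le x\le a$, $0\le y\le b$, $c_0\le x+y\le a+b-c_2$, $c_3-b\le x-y\le a-c_1$.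
   Formalization: For d=1 the stated shape fails: {(0,0),(1,0)} is optimal but is not a rotation by π/2 or translate of O(1,1,0,1,0,1)={(0,0),(1,1)}; the formal theorem allows, for d=1 only, also O(1,0,0,0,0,0) up to rotation and translation. *)

(* Defs.v *)
From mathcomp Require Import all_boot all_order all_algebra.
From mathcomp Require Import finmap.
From mathcomp Require Import boolp classical_sets functions cardinality.
From mathcomp Require Import zify.

Set Implicit Arguments.
Unset Strict Implicit.
Unset Printing Implicit Defensive.
Import Order.TTheory GRing.Theory Num.Theory.
Local Open Scope ring_scope.

Definition king_adj (u v : int * int) : bool :=
  Num.max `|u.1 - v.1| `|u.2 - v.2| == 1.

(* A finite subgraph is given by its vertices V and its edges E, an edge being
   the unordered pair of its endpoints. *)
Definition edge_rel (E : {fset {fset int * int}}) : rel (int * int) :=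
  fun u v => [fset u; v]%fset \in E.

Definition king_subgraph (V : {fset int * int}) (E : {fset {fset int * int}}) :=
  forall e, e \in E ->
    exists u v, [/\ u \in V, v \in V, king_adj u v & e = [fset u; v]%fset].

Definition connected (V : {fset int * int}) (E : {fset {fset int * int}}) :=
  forall u v, u \in V -> v \in V ->
    exists2 p, path (edge_rel E) u p & last u p = v.

(* ucycle also accepts a single edge traversed back and forth, a closed
   sequence of length 2, which is not a cycle of the graph. *)
Definition acyclic (E : {fset {fset int * int}}) :=
  forall c, ucycle (edge_rel E) c -> (size c <= 2)%N.

Definition king_tree (V : {fset int * int}) (E : {fset {fset int * int}}) :=
  [/\ V != fset0, king_subgraph V E, connected V E & acyclic E].

Definition tree_through (z1 z2 z3 : int * int) (n : nat) : Prop :=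
  exists V E, [/\ king_tree V E, z1 \in V, z2 \in V, z3 \in V & #|` E| = n].

Lemma king_tree1 (z : int * int) : king_tree [fset z]%fset fset0.
Proof.
split=> [|e|u v|c].
- by apply/fset0Pn; exists z; rewrite inE.
- by rewrite inE.
- by rewrite !inE => /eqP-> /eqP->; exists [::].
- case: c => [|x [|y s]] // /andP[/= /andP[]]; by rewrite /edge_rel inE.
Qed.

Lemma king_adj_neq u v : king_adj u v -> u != v.
Proof. by apply: contraTneq => ->; rewrite /king_adj !subrr normr0. Qed.

Lemma edge_relC E : symmetric (edge_rel E).
Proof. by move=> x y; rewrite /edge_rel fsetUC. Qed.

Lemma edge_rel_in V E x y : king_subgraph V E -> edge_rel E x y ->
  (x \in V) * (y \in V).
Proof.
move=> sub /sub [u [v [uV vV _ eq_xy]]].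
have : x \in [fset u; v]%fset by rewrite -eq_xy !inE eqxx.
have : y \in [fset u; v]%fset by rewrite -eq_xy !inE eqxx orbT.
by rewrite !inE => /orP[]/eqP-> /orP[]/eqP->; rewrite ?uV ?vV.
Qed.

Lemma king_tree_pendant V E u w : king_tree V E -> u \in V -> w \notin V ->
  king_adj u w ->
  king_tree (w |` V)%fset ([fset u; w] |` E)%fset.
Proof.
move=> [V0 sub conn acyc] uV wV uw; set E' := (_ |` E)%fset.
have new x : edge_rel E' w x -> x = u.
  rewrite /edge_rel !inE => /orP[/eqP eq_wx|/(edge_rel_in sub)[]]; last first.
    by rewrite (negPf wV).
  have : u \in [fset w; x]%fset by rewrite eq_wx !inE eqxx.
  by rewrite !inE (negPf (king_adj_neq uw)) => /eqP.
have old x y : x != w -> y != w -> edge_rel E' x y -> edge_rel E x y.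
  rewrite /edge_rel !inE => xw yw /orP[/eqP eq_xy|//].
  have : w \in [fset x; y]%fset by rewrite eq_xy !inE eqxx orbT.
  by rewrite !inE ![w == _]eq_sym (negPf xw) (negPf yw).
have subr : subrel (edge_rel E) (edge_rel E').
  by move=> x y; rewrite /edge_rel !inE => ->; rewrite orbT.
have uwE' : edge_rel E' u w by rewrite /edge_rel !inE eqxx.
split.
- by apply/fset0Pn; exists w; rewrite !inE eqxx.
- move=> e; rewrite !inE => /orP[/eqP->|/sub[x [y [xV yV xy ->]]]].
    by exists u, w; rewrite !inE uV eqxx orbT.
  by exists x, y; rewrite !inE xV yV !orbT.
- move=> x y; rewrite !inE => /orP[/eqP->|xV] /orP[/eqP->|yV].
  + by exists [::].
  + have [p pth <-] := conn _ _ uV yV; exists (u :: p) => //=.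
    by rewrite edge_relC uwE' (sub_path subr).
  + have [p pth lst] := conn _ _ xV uV; exists (rcons p w); last first.
      by rewrite last_rcons.
    by rewrite rcons_path (sub_path subr pth) lst uwE'.
  + by have [p pth lst] := conn _ _ xV yV; exists p; rewrite ?(sub_path subr).
- move=> c /andP[cyc unq]; have [wc|wc] := boolP (w \in c); last first.
    apply: acyc; rewrite /ucycle unq andbT; case: c wc cyc {unq} => // x s wc.
    have : all (fun y => y != w) (x :: s).
      by apply/allP => y ys; apply: contraNneq wc => <-.
    move=> /[dup] all_xs /=; case/andP=> xw sw.
    apply: (@sub_in_path _ (fun y => y != w)) => [y z yw zw|]; first exact: old.
    by rewrite /= xw all_rcons sw xw.
  have [i s eq_c] := rot_to wc.
  have cyc' : cycle (edge_rel E') (w :: s) by rewrite -eq_c rot_cycle.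
  have unq' : uniq (w :: s) by rewrite -eq_c rot_uniq.
  rewrite -(size_rot i) eq_c.
  case: s cyc' unq' {eq_c} => [|x s] // /= /andP[/new->].
  rewrite rcons_path edge_relC => /andP[_ /new lst] /and3P[_ + _].
  by case: s lst => // y s /= <-; rewrite mem_last.
Qed.

Lemma king_tree_step V E u w : king_tree V E -> u \in V -> king_adj u w ->
  exists V' E', [/\ king_tree V' E', {subset V <= V'} & w \in V'].
Proof.
move=> tr uV uw; have [wV|wV] := boolP (w \in V); first by exists V, E; split.
exists (w |` V)%fset, ([fset u; w] |` E)%fset; split.
- exact: king_tree_pendant.
- by move=> x xV; rewrite !inE xV orbT.
- by rewrite !inE eqxx.
Qed.

Lemma king_tree_extend V E u w : king_tree V E -> u \in V ->
  exists V' E', [/\ king_tree V' E', {subset V <= V'} & w \in V'].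
Proof.
pose dist (v : int * int) := (absz (w.1 - v.1) + absz (w.2 - v.2))%N.
have [n] := ubnP (dist u).
elim: n => // n IHn in V E u * => lt_n tr uV.
have [<-|/eqP neq] := eqVneq u w; first by exists V, E; split.
have [v uv lt_v] : exists2 v, king_adj u v & (dist v < dist u)%N.
  rewrite /dist /king_adj; clear - neq; case: u w neq => [x y] [x' y'] /= neq.
  have [ltx|ltx|eqx] := ltgtP x x'.
  - exists (x + 1, y); rewrite /=; last lia.
    by rewrite subrr (_ : x - (x + 1) = -1) //; lia.
  - exists (x - 1, y); rewrite /=; last lia.
    by rewrite subrr (_ : x - (x - 1) = 1) //; lia.
  have [lty|lty|eqy] := ltgtP y y'.
  - exists (x, y + 1); rewrite /=; last lia.
    by rewrite subrr (_ : y - (y + 1) = -1) //; lia.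
  - exists (x, y - 1); rewrite /=; last lia.
    by rewrite subrr (_ : y - (y - 1) = 1) //; lia.
  - by case: neq; rewrite eqx eqy.
have [V1 [E1 [tr1 sub1 vV1]]] := king_tree_step tr uV uv.
have [|V2 [E2 [tr2 sub2 wV2]]] := IHn _ _ v _ tr1 vV1.
  by rewrite (leq_trans lt_v).
by exists V2, E2; split=> // z /sub1/sub2.
Qed.

Lemma tree_through_ex z1 z2 z3 : exists n, `[< tree_through z1 z2 z3 n >].
Proof.
have z1V : z1 \in [fset z1]%fset by rewrite inE.
have [V [E [tr sub z2V]]] := king_tree_extend z2 (king_tree1 z1) z1V.
have [V' [E' [tr' sub' z3V]]] := king_tree_extend z3 tr z2V.
exists #|` E'|; apply/asboolP; exists V', E'.
by split=> //; [exact/sub'/sub | exact: sub'].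
Qed.

Definition tristance (z1 z2 z3 : int * int) : nat :=
  ex_minn (tree_through_ex z1 z2 z3).

Local Open Scope classical_set_scope.
Local Open Scope card_scope.

Definition anticode (d : nat) (A : set (int * int)) : Prop :=
  forall z1 z2 z3, A z1 -> A z2 -> A z3 -> (tristance z1 z2 z3 <= d)%N.

Definition optimal_anticode (d : nat) (A : set (int * int)) : Prop :=
  anticode d A /\ forall B, anticode d B -> B #<= A.

Definition octagon (a b c0 c1 c2 c3 : int) : set (int * int) :=
  [set z | [/\ 0 <= z.1 <= a, 0 <= z.2 <= b,
               c0 <= z.1 + z.2 <= a + b - c2 &
               c3 - b <= z.1 - z.2 <= a - c1]].

Definition rot90 (z : int * int) : int * int := (- z.2, z.1).

Definition same_up_to_rot90_translation (A B : set (int * int)) : Prop :=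
  exists v : int * int,
    A = [set z + v | z in B] \/ A = [set rot90 z + v | z in B].

(* The equations are between rationals, so divisions by 7 are exact; the last
   branch is the residue 6. *)
Definition optimal_parameters (d : nat) (a c0 c1 : int) : Prop :=
  let D : rat := d%:R in
  let are (a' c0' c1' : rat) :=
    [/\ a%:~R = a', c0%:~R = c0' & c1%:~R = c1'] in
  match (d %% 7)%N with
  | 0%N => are (6 * D / 7)       (2 * D / 7)       (2 * D / 7)
  | 1%N => are ((6 * D + 1) / 7) ((2 * D - 2) / 7) ((2 * D + 5) / 7)
  | 2%N => are ((6 * D + 2) / 7) ((2 * D + 3) / 7) ((2 * D + 3) / 7)
  | 3%N => are ((6 * D - 4) / 7) ((2 * D - 6) / 7) ((2 * D - 6) / 7)
  | 4%N => are ((6 * D - 3) / 7) ((2 * D - 8) / 7) ((2 * D - 1) / 7)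
  | 5%N => are ((6 * D - 2) / 7) ((2 * D - 3) / 7) ((2 * D - 3) / 7)
  | _   => are ((6 * D - 1) / 7) ((2 * D - 5) / 7) ((2 * D + 2) / 7)
  end.

(* Main.v *)
(* In the coordinates u = x + y, v = x - y the king distance is half the
   L1 distance, and the tristance of a triple is half of (range of u) +
   (range of v), rounded up: every edge of a tree changes u and v by 2 in total,
   and the pair of medians, shifted by one if the parities differ, is the centre
   of an optimal star.  Two of the four extremal points of a triple coincide, so
   being an anticode amounts to four linear inequalities on the extrema of x, y,
   u and v; hence an optimal anticode is a full octagon, with
   (a + 1)(b + 1) - sum_i c_i (c_i + 1) / 2 points.  Completing squares, 56
   times this number is 4 (8 d^2 + 16 d + 15) minus a sum of squares and of a
   slack term; the claimed octagon forces this loss to be at most 44, which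
   leaves only the stated parameters, and the domino for d = 1. *)

Require Import Defs.
From mathcomp Require Import all_boot all_order all_algebra.
From mathcomp Require Import finmap.
From mathcomp Require Import boolp classical_sets functions cardinality.
From mathcomp Require Import zify ring.

Set Implicit Arguments.
Unset Strict Implicit.
Unset Printing Implicit Defensive.
Import Order.TTheory GRing.Theory Num.Theory.
Local Open Scope classical_set_scope.
Local Open Scope card_scope.
Local Open Scope ring_scope.

(** * Tristance *)

Definition usum (z : int * int) : int := z.1 + z.2.
Definition vdiff (z : int * int) : int := z.1 - z.2.

(** Summing over ordered pairs needs no choice of first endpoint. Each edge is counted in both
    directions, hence the factor 2 in what follows. *)
Definition edge_weight (f : int * int -> int) (e : {fset int * int}) : nat :=
  (\sum_(x <- e) \sum_(y <- e) `|f x - f y|)%N.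

Lemma perm_fset2 (x y : int * int) : x != y ->
  perm_eq (enum_fset [fset x; y]%fset) [:: x; y].
Proof.
move=> xy; apply: uniq_perm; rewrite ?fset_uniq //= ?inE ?xy // => z.
by rewrite !inE.
Qed.

Lemma edge_weight2 f x y : x != y ->
  edge_weight f [fset x; y]%fset = (2 * `|f x - f y|)%N.
Proof.
move=> xy; rewrite /edge_weight (perm_big _ (perm_fset2 xy)) /=.
rewrite !big_cons big_nil !(perm_big _ (perm_fset2 xy)) /= !big_cons !big_nil.
lia.
Qed.

(** Since [|a + b| + |a - b| = 2 * max(|a|, |b|)], a king move changes [usum] and [vdiff] by 2 in
    total, and [edge_weight] doubles this. *)
Lemma king_adj_weight x y : king_adj x y ->
  (edge_weight usum [fset x; y]%fset + edge_weight vdiff [fset x; y]%fset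
    = 4)%N.
Proof.
move=> /[dup] /king_adj_neq xy; rewrite /king_adj !edge_weight2 //.
rewrite /usum /vdiff => /eqP; lia.
Qed.

Lemma leq_sum_subset (T : eqType) (s t : seq T) (F : T -> nat) :
  uniq s -> uniq t -> {subset s <= t} ->
  (\sum_(i <- s) F i <= \sum_(i <- t) F i)%N.
Proof.
move=> us ut st; rewrite [leqRHS](bigID (mem s)) /=.
rewrite -[X in (_ <= X + _)%N]big_filter.
rewrite (perm_big (filter (mem s) t)) ?leq_addr //.
apply: uniq_perm; rewrite ?filter_uniq // => x; rewrite mem_filter /=.
by case: (boolP (x \in s)) => //= /st.
Qed.

Definition path_edges (x : int * int) s : seq {fset int * int} :=
  pairmap (fun a b => [fset a; b]%fset) x s.

Lemma path_edges_sub x s (e : {fset int * int}) y :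
  e \in path_edges x s -> y \in e -> y \in x :: s.
Proof.
elim: s x => //= z s IHs x; rewrite inE => /orP[/eqP-> | /IHs /[apply]].
  by rewrite !inE => /orP[]->; rewrite ?orbT.
by rewrite !inE => ->; rewrite orbT.
Qed.

Lemma path_edges_uniq x s : uniq (x :: s) -> uniq (path_edges x s).
Proof.
elim: s x => //= z s IHs x /andP[xs zs]; rewrite IHs // andbT.
apply: contra xs => /path_edges_sub; apply; exact: fset21.
Qed.

Lemma path_edges_all E x s : path (edge_rel E) x s ->
  {subset path_edges x s <= E}.
Proof.
elim: s x => //= z s IHs x /andP[xz /IHs sub] e; rewrite inE.
by case/orP=> [/eqP->|/sub].
Qed.

Lemma path_weight f x s : uniq (x :: s) ->
  2 * (f (last x s) - f x) <= (\sum_(e <- path_edges x s) edge_weight f e)%N.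
Proof.
elim: s x => [|z s IHs] x /=; first by rewrite big_nil subrr.
move=> /andP[xs zs]; rewrite big_cons edge_weight2; last first.
  by apply: contraNneq xs => ->; exact: mem_head.
have := IHs z zs; rewrite -/(path_edges z s).
move: (f x) (f z) (f _) (\sum_(e <- _) _)%N => a b c S; lia.
Qed.

(** A path from [q] to [p] shortens to one without repeated vertices; its edges are then distinct
    members of [E], so their weights form part of the total. *)
Lemma connected_weight f V E p q : connected V E -> p \in V -> q \in V ->
  2 * (f p - f q) <= (\sum_(e <- E) edge_weight f e)%N.
Proof.
move=> conn pV qV; have [s0 + <-] := conn _ _ qV pV.
case/shortenP=> s pth us _; apply: (le_trans (path_weight f us)).
rewrite lez_nat; apply: leq_sum_subset; rewrite ?path_edges_uniq ?fset_uniq //.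
exact: path_edges_all.
Qed.

(** The paths joining [q] to [p] and [s] to [r] may share edges: one is charged to the [usum]
    weight, the other to the [vdiff] weight, and these add up to 4 on every edge. *)
Lemma king_tree_spread V E p q r s : king_tree V E ->
  p \in V -> q \in V -> r \in V -> s \in V ->
  usum p - usum q + vdiff r - vdiff s <= 2 * #|` E|%:Z.
Proof.
case=> _ sub conn _ pV qV rV sV.
have := connected_weight usum conn pV qV.
have := connected_weight vdiff conn rV sV.
suff : (\sum_(e <- E) edge_weight usum e + \sum_(e <- E) edge_weight vdiff e
        = 4 * #|` E|)%N by lia.
rewrite -big_split /= (eq_big_seq (fun=> 4%N)); last first.
  by move=> e /sub[x [y [_ _ xy ->]]]; exact: king_adj_weight.
by rewrite big_const_seq count_predT iter_addn addn0.
Qed.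

Definition king_dist (u w : int * int) : nat :=
  maxn `|u.1 - w.1| `|u.2 - w.2|.

(** Each king move toward [w] adds at most one edge, and none when it lands on a vertex already in
    the tree. *)
Lemma king_tree_reach V E u w : king_tree V E -> u \in V ->
  exists V' E', [/\ king_tree V' E', {subset V <= V'}, w \in V' &
    (#|` E'| <= #|` E| + king_dist u w)%N].
Proof.
have [n] := ubnP (king_dist u w).
elim: n => // n IHn in V E u * => lt_n tr uV.
have [<-|/eqP neq] := eqVneq u w.
  by exists V, E; split; rewrite ?leq_addr.
pose v := (u.1 + Num.sg (w.1 - u.1), u.2 + Num.sg (w.2 - u.2)).
have [uv dv] : king_adj u v /\ king_dist u w = (king_dist v w).+1.
  have {neq} : u.1 <> w.1 \/ u.2 <> w.2.
    case: (eqVneq u.1 w.1) => [eqx|/eqP]; [right=> eqy|by left].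
    by apply: neq; rewrite (surjective_pairing u) eqx eqy -surjective_pairing.
  rewrite /king_adj /king_dist /v /=.
  by case: (sgrP (w.1 - u.1)); case: (sgrP (w.2 - u.2)) => /= *; split; lia.
have [V1 [E1 [tr1 sub1 vV1 E1le]]] :
    exists V1 E1, [/\ king_tree V1 E1, {subset V <= V1}, v \in V1 &
    (#|` E1| <= #|` E|.+1)%N].
  have [vV|vV] := boolP (v \in V); first by exists V, E; split.
  exists (v |` V)%fset, ([fset u; v] |` E)%fset; split.
  - exact: king_tree_pendant.
  - by move=> x xV; rewrite !inE xV orbT.
  - by rewrite !inE eqxx.
  - by rewrite cardfsU1; case: (_ \notin _).
have [|V2 [E2 [tr2 sub2 wV2 E2le]]] := IHn _ _ v _ tr1 vV1; first by lia.
by exists V2, E2; split=> // [z /sub1/sub2 //|]; lia.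
Qed.

Lemma tristance_le_star (w z1 z2 z3 : int * int) :
  (tristance z1 z2 z3 <= king_dist w z1 + king_dist w z2 + king_dist w z3)%N.
Proof.
have w0 : w \in [fset w]%fset by rewrite inE.
have [V1 [E1 [tr1 s1 m1 l1]]] := king_tree_reach z1 (king_tree1 w) w0.
have [V2 [E2 [tr2 s2 m2 l2]]] := king_tree_reach z2 tr1 (s1 _ w0).
have [V3 [E3 [tr3 s3 m3 l3]]] := king_tree_reach z3 tr2 (s2 _ (s1 _ w0)).
rewrite /tristance; case: ex_minnP => n _ min_n.
have le_n : (n <= #|` E3|)%N.
  apply: min_n; apply/asboolP; exists V3, E3; split=> //.
  - exact/s3/s2.
  - exact/s3.
have E0 : #|` (fset0 : {fset {fset int * int}})| = 0%N by rewrite cardfs0.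
lia.
Qed.

(* The second alternative lets one move the median by one to repair a parity
   mismatch between the medians of [usum] and [vdiff]. *)
Lemma median3 (T : eqType) (f : T -> int) (x y z : T) :
  exists p q (m : int), [/\ p \in [:: x; y; z], q \in [:: x; y; z],
    `|f x - m| + `|f y - m| + `|f z - m| = f p - f q &
    [/\ f x = m, f y = m & f z = m] \/
    exists2 m', `|m' - m| = 1 &
      `|f x - m'| + `|f y - m'| + `|f z - m'| = f p - f q + 1].
Proof.
have sorted a b c : f a <= f b -> f b <= f c -> exists m : int,
    `|f a - m| + `|f b - m| + `|f c - m| = f c - f a /\
    ([/\ f a = m, f b = m & f c = m] \/ exists2 m', `|m' - m| = 1 &
      `|f a - m'| + `|f b - m'| + `|f c - m'| = f c - f a + 1).
  move=> ab bc; exists (f b); split; first lia.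
  (* Moving off the median toward a value strictly on one side brings one point closer and leaves
     two farther, a net cost of 1. This fails only when all three values agree. *)
  have [lt_bc|le_cb] := ltP (f b) (f c); first by right; exists (f b + 1); lia.
  have [lt_ab|le_ba] := ltP (f a) (f b); first by right; exists (f b - 1); lia.
  by left; split; lia.
have [xy|yx] := leP (f x) (f y); have [yz|zy] := leP (f y) (f z);
  have [xz|zx] := leP (f x) (f z); try (exfalso; lia).
- have [m [e h]] := sorted x y z xy yz.
  exists z, x, m; rewrite !inE !eqxx ?orbT; split=> //.
- have [m [e h]] := sorted x z y xz (ltW zy).
  exists y, x, m; rewrite !inE !eqxx ?orbT; split=> //; first lia.
  by case: h => [[]|[m' h1 h2]]; [left|right; exists m'; lia].
- have [m [e h]] := sorted z x y (ltW zx) xy.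
  exists y, z, m; rewrite !inE !eqxx ?orbT; split=> //; first lia.
  by case: h => [[]|[m' h1 h2]]; [left|right; exists m'; lia].
- have [m [e h]] := sorted y x z (ltW yx) xz.
  exists z, y, m; rewrite !inE !eqxx ?orbT; split=> //; first lia.
  by case: h => [[]|[m' h1 h2]]; [left|right; exists m'; lia].
- have [m [e h]] := sorted y z x yz (ltW zx).
  exists x, y, m; rewrite !inE !eqxx ?orbT; split=> //; first lia.
  by case: h => [[]|[m' h1 h2]]; [left|right; exists m'; lia].
- have [m [e h]] := sorted z y x (ltW zy) (ltW yx).
  exists x, z, m; rewrite !inE !eqxx ?orbT; split=> //; first lia.
  by case: h => [[]|[m' h1 h2]]; [left|right; exists m'; lia].
Qed.

(** The parity hypothesis says that [s] and [t] are the [usum] and [vdiff] of a lattice point. *)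
Lemma king_distE (s t : int) (z : int * int) : (2 %| s - t)%Z ->
  2 * (king_dist (((s + t) %/ 2)%Z, ((s - t) %/ 2)%Z) z)%:Z =
  `|usum z - s| + `|vdiff z - t|.
Proof. by rewrite /king_dist /usum /vdiff => /= st; lia. Qed.

Lemma tristanceP (d : nat) (z1 z2 z3 : int * int) :
  (tristance z1 z2 z3 <= d)%N <->
  (forall p q r s, p \in [:: z1; z2; z3] -> q \in [:: z1; z2; z3] ->
     r \in [:: z1; z2; z3] -> s \in [:: z1; z2; z3] ->
     usum p - usum q + vdiff r - vdiff s <= 2 * d%:Z).
Proof.
split=> [le_d p q r s|spread].
  move: le_d; rewrite /tristance; case: ex_minnP => n.
  move=> /asboolP[V [E [tr z1V z2V z3V <-]]] _ le_d.
  have sub z : z \in [:: z1; z2; z3] -> z \in V.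
    by rewrite !inE => /or3P[]/eqP->.
  move=> /sub pV /sub qV /sub rV /sub sV.
  have := king_tree_spread tr pV qV rV sV; lia.
have [p [q [m [pz qz em hm]]]] := median3 usum z1 z2 z3.
have [r [s [n [rz sz en hn]]]] := median3 vdiff z1 z2 z3.
have le_d := spread p q r s pz qz rz sz.
(* The extra 1 is harmless: the left side is twice a sum of king distances, hence even. *)
have [s0 [t0 [par le_s]]] : exists s0 t0 : int, (2 %| s0 - t0)%Z /\
    `|usum z1 - s0| + `|usum z2 - s0| + `|usum z3 - s0| +
    (`|vdiff z1 - t0| + `|vdiff z2 - t0| + `|vdiff z3 - t0|) <= 2 * d%:Z + 1.
  have [even|odd] := boolP (2 %| m - n)%Z; first by exists m, n; lia.
  case: hm => [[um _ _]|[m' mm' em']]; last by exists m', n; lia.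
  case: hn => [[vn _ _]|[n' nn' en']]; last by exists m, n'; lia.
  (* If neither median can be shifted, both are values at [z1], where [usum] and [vdiff] have equal
     parity. *)
  by move: odd; rewrite -um -vn /usum /vdiff; lia.
have := tristance_le_star (((s0 + t0) %/ 2)%Z, ((s0 - t0) %/ 2)%Z) z1 z2 z3.
have := king_distE z1 par; have := king_distE z2 par; have := king_distE z3 par.
lia.
Qed.

(** * Anticodes and octagons *)

Lemma fst_add (z t : int * int) : (z + t).1 = z.1 + t.1. Proof. by []. Qed.
Lemma snd_add (z t : int * int) : (z + t).2 = z.2 + t.2. Proof. by []. Qed.

(* Among the four extremal points of [usum] and [vdiff] in a triple two
   coincide, and [usum +- vdiff] is twice a coordinate. *)
Lemma anticodeP d (A : set (int * int)) : anticode d A <->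
  (forall p q r, A p -> A q -> A r ->
    [/\ 2 * p.1 - usum q - vdiff r <= 2 * d%:Z,
        2 * p.2 - usum q + vdiff r <= 2 * d%:Z,
        - (2 * p.2) + usum q - vdiff r <= 2 * d%:Z &
        - (2 * p.1) + usum q + vdiff r <= 2 * d%:Z]).
Proof.
split=> [anti p q r Ap Aq Ar|supp z1 z2 z3 A1 A2 A3].
  have /tristanceP spread := anti p q r Ap Aq Ar.
  have pT : p \in [:: p; q; r] by rewrite !inE eqxx.
  have qT : q \in [:: p; q; r] by rewrite !inE eqxx orbT.
  have rT : r \in [:: p; q; r] by rewrite !inE eqxx !orbT.
  have := spread p q p r pT qT pT rT; have := spread p q r p pT qT rT pT.
  have := spread q p p r qT pT pT rT; have := spread q p r p qT pT rT pT.
  by rewrite /usum /vdiff; split; lia.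
apply/tristanceP => p q r s pz qz rz sz.
have sub z : z \in [:: z1; z2; z3] -> A z by rewrite !inE => /or3P[]/eqP->.
have [[[Ap Aq] Ar] As] := (sub p pz, sub q qz, sub r rz, sub s sz).
have : [|| p == r, p == s, q == r, q == s, p == q | r == s].
  move: pz qz rz sz; rewrite !inE.
  by do 4![case/or3P=> /eqP->]; rewrite !eqxx ?orbT.
case/or4P=> [/eqP pr|/eqP ps|/eqP qr|/or3P[]/eqP qs].
- by have [+ _ _ _] := supp p q s Ap Aq As; rewrite -pr /usum /vdiff; lia.
- by have [_ + _ _] := supp p q r Ap Aq Ar; rewrite -ps /usum /vdiff; lia.
- by have [_ _ + _] := supp q p s Aq Ap As; rewrite -qr /usum /vdiff; lia.
- by have [_ _ _ +] := supp q p r Aq Ap Ar; rewrite -qs /usum /vdiff; lia.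
(* In the last two cases one range vanishes, and repeating a point isolates the other:
   [2 * r.1 - usum r = vdiff r]. *)
- by have [+ _ _ _] := supp r r s Ar Ar As; rewrite -qs /usum /vdiff; lia.
- by have [+ _ _ _] := supp p q p Ap Aq Ap; rewrite -qs /usum /vdiff; lia.
Qed.

Lemma anticode_translate d (A : set (int * int)) t :
  anticode d A -> anticode d [set z + t | z in A].
Proof.
move/anticodeP=> anti; apply/anticodeP=> _ _ _ [p Ap <-] [q Aq <-] [r Ar <-].
have [] := anti p q r Ap Aq Ar; rewrite /usum /vdiff !fst_add !snd_add.
by split; lia.
Qed.

(** These are the inequalities of [anticodeP] with each term replaced by its bound on the octagon;
    the first is [2 * a - c0 - (c3 - b) <= 2 * d]. *)
Definition octagon_diameter_le (d : nat) (a b c0 c1 c2 c3 : int) : Prop :=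
  [/\ 2 * a + b <= c0 + c3 + 2 * d%:Z, 2 * a + b <= c1 + c2 + 2 * d%:Z,
      a + 2 * b <= c0 + c1 + 2 * d%:Z & a + 2 * b <= c2 + c3 + 2 * d%:Z].

(* The cut-off corners are full, pairwise disjoint triangles. *)
Definition octagon_cuts (a b c0 c1 c2 c3 : int) : Prop :=
  [/\ [/\ 0 <= c0, 0 <= c1, 0 <= c2 & 0 <= c3],
      c0 + c1 <= a, c1 + c2 <= b, c2 + c3 <= a & c0 + c3 <= b].

Lemma octagon_anticode d a b c0 c1 c2 c3 :
  octagon_diameter_le d a b c0 c1 c2 c3 ->
  anticode d (octagon a b c0 c1 c2 c3).
Proof.
move=> [h1 h2 h3 h4]; apply/anticodeP => p q r.
rewrite /octagon /usum /vdiff /=.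
move=> [/andP[p1 p2] /andP[p3 p4] _ _] [_ _ /andP[q1 q2] _].
by move=> [_ _ _ /andP[r1 r2]]; split; lia.
Qed.

Lemma int_max (T : Type) (A : set T) (f : T -> int) (M : int) z0 : A z0 ->
  (forall z, A z -> f z <= M) -> exists2 z, A z & forall w, A w -> f w <= f z.
Proof.
move=> A0 ub.
have ex : exists n, `[< exists2 z, A z & `|M - f z|%N = n >].
  by exists `|M - f z0|%N; apply/asboolP; exists z0.
case: (ex_minnP ex) => n /asboolP[z Az zn] min_n; exists z => // w Aw.
have /min_n : `[< exists2 z, A z & `|M - f z|%N = `|M - f w|%N >].
  by apply/asboolP; exists w.
by have := ub z Az; have := ub w Aw; lia.
Qed.

(** The octagon is cut out by the extreme values of [x], [y], [usum] and [vdiff] on [A]. Points of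
    [A] attain them, so the diameter inequalities are instances of [anticodeP], and the cuts cannot
    overlap because every side of the bounding box meets [A]. *)
Lemma anticode_sub_octagon d (A : set (int * int)) : anticode d A -> A !=set0 ->
  exists t a b c0 c1 c2 c3,
    [/\ octagon_diameter_le d a b c0 c1 c2 c3,
        octagon_cuts a b c0 c1 c2 c3 &
        A `<=` [set z + t | z in octagon a b c0 c1 c2 c3]].
Proof.
move=> /anticodeP anti [z0 A0].
pose M : int := 2 * d%:Z + 4 * (`|z0.1| + `|z0.2|).
have bnd z : A z -> [/\ z.1 <= M, - z.1 <= M, z.2 <= M & - z.2 <= M] /\
    [/\ usum z <= M, - usum z <= M, vdiff z <= M & - vdiff z <= M].
  move=> Az; have := anti z z0 z0 Az A0 A0; have := anti z0 z z0 A0 Az A0.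
  have := anti z0 z0 z A0 A0 Az; rewrite /M /usum /vdiff.
  by move=> [? ? ? ?] [? ? ? ?] [? ? ? ?]; split; split; lia.
have max f : (forall z, A z -> f z <= M) -> _ := @int_max _ A f M z0 A0.
have [|xM AxM xMP] := max (fun z => z.1); first by move=> z /bnd[[]].
have [|xm Axm xmP] := max (fun z => - z.1); first by move=> z /bnd[[]].
have [|yM AyM yMP] := max (fun z => z.2); first by move=> z /bnd[[]].
have [|ym Aym ymP] := max (fun z => - z.2); first by move=> z /bnd[[]].
have [|uM AuM uMP] := max (fun z => usum z); first by move=> z /bnd[_ []].
have [|um Aum umP] := max (fun z => - usum z); first by move=> z /bnd[_ []].
have [|vM AvM vMP] := max (fun z => vdiff z); first by move=> z /bnd[_ []].
have [|vm Avm vmP] := max (fun z => - vdiff z); first by move=> z /bnd[_ []].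
have bound z (Az : A z) := (And4 (xMP z Az) (xmP z Az) (yMP z Az) (ymP z Az),
  And4 (uMP z Az) (umP z Az) (vMP z Az) (vmP z Az)).
pose a := xM.1 - xm.1; pose b := yM.2 - ym.2.
exists (xm.1, ym.2), a, b, (usum um - xm.1 - ym.2),
  (a - (vdiff vM - xm.1 + ym.2)), (a + b - (usum uM - xm.1 - ym.2)),
  (b + (vdiff vm - xm.1 + ym.2)).
have [d1 _ _ _] := anti xM um vm AxM Aum Avm.
have [_ d2 _ _] := anti yM um vM AyM Aum AvM.
have [_ _ d3 _] := anti ym uM vm Aym AuM Avm.
have [_ _ _ d4] := anti xm uM vM Axm AuM AvM.
split.
- by rewrite /a /b; split; lia.
- have [[xM1 xM2 xM3 xM4] [xM5 xM6 xM7 xM8]] := bound _ AxM.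
  have [[xm1 xm2 xm3 xm4] [xm5 xm6 xm7 xm8]] := bound _ Axm.
  have [[yM1 yM2 yM3 yM4] [yM5 yM6 yM7 yM8]] := bound _ AyM.
  have [[ym1 ym2 ym3 ym4] [ym5 ym6 ym7 ym8]] := bound _ Aym.
  have [[uM1 uM2 uM3 uM4] _] := bound _ AuM.
  have [[um1 um2 um3 um4] _] := bound _ Aum.
  have [[vM1 vM2 vM3 vM4] _] := bound _ AvM.
  have [[vm1 vm2 vm3 vm4] _] := bound _ Avm.
  rewrite /octagon_cuts /a /b.
  rewrite /usum /vdiff in xM5 xM6 xM7 xM8 xm5 xm6 xm7 xm8 *.
  rewrite /usum /vdiff in yM5 yM6 yM7 yM8 ym5 ym6 ym7 ym8 *.
  by split; first split; lia.
- move=> z Az; exists (z - (xm.1, ym.2)); last by rewrite subrK.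
  have [[z1 z2 z3 z4] [z5 z6 z7 z8]] := bound z Az.
  rewrite /octagon /= /a /b; rewrite /usum /vdiff in z5 z6 z7 z8 *.
  by split; apply/andP; split; lia.
Qed.

(** * Counting the lattice points of an octagon *)

Lemma sum_subn_const n c : (c <= n)%N ->
  (2 * \sum_(0 <= x < n) (c - x) = c * c.+1)%N.
Proof.
elim: n c => [|n IHn] c le_cn.
  by move: le_cn; rewrite leqn0 => /eqP->; rewrite big_geq.
case: c le_cn => [|c] le_cn.
  by rewrite big_nat_cond big1 // => x _; rewrite sub0n.
rewrite big_nat_recl // mulnDr subn0.
rewrite (eq_bigr (fun x => c - x)%N) => [|x _]; last by rewrite subSS.
by rewrite IHn //; lia.
Qed.

Lemma sum_const_subn n k : (k <= n)%N ->
  (2 * \sum_(0 <= x < n) (x - k) = (n - k) * (n - k).-1)%N.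
Proof.
elim: n => [|n IHn]; first by rewrite leqn0 => /eqP->; rewrite big_geq.
rewrite leq_eqVlt => /orP[/eqP->|le_kn].
  rewrite subnn mul0n big_nat_cond big1 // => x /andP[/andP[_ ltx] _]; lia.
rewrite big_nat_recr //= mulnDr IHn //; have : (n - k).+1 = (n.+1 - k)%N by lia.
by case: (n - k)%N => [|m] <- /=; lia.
Qed.


(* Row [x] of the octagon; at most one cut is active at each end, hence the
   truncated subtractions may be added. *)
Lemma octagon_enum (a b c0 c1 c2 c3 : nat) :
  octagon_cuts a%:Z b%:Z c0%:Z c1%:Z c2%:Z c3%:Z ->
  exists s : seq (int * int), [/\ uniq s,
    octagon a b c0 c1 c2 c3 = [set` s] &
    (2 * size s + c0 * c0.+1 + c1 * c1.+1 + c2 * c2.+1 + c3 * c3.+1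
       = 2 * a.+1 * b.+1)%N].
Proof.
move=> [_ c01 c12 c23 c03].
pose bot x := (c0 - x + (x - (a - c1)))%N.
pose top x := (b - (c3 - x + (x - (a - c2))))%N.
pose len x := ((top x).+1 - bot x)%N.
pose s := [seq (x%:Z, y%:Z) | x <- iota 0 a.+1, y <- iota (bot x) (len x)].
exists s.
split.
- apply: allpairs_uniq_dep => [|x _|[x y] [x' y'] _ _ /= [-> ->]] //.
  + exact: iota_uniq.
  + exact: iota_uniq.
- apply/seteqP; split=> [[x y]|z zs]; last first.
    have /allpairsPdep[x [y [+ + ->]]] : z \in s by exact: zs.
    rewrite !mem_iota /len /bot /top /octagon /= => hx hy.
    by split; lia.
  rewrite /octagon /= => -[/andP[x0 xa] /andP[y0 yb] /andP[? ?] /andP[? ?]].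
  suff : (x, y) \in s by [].
  apply/allpairsPdep; exists `|x|%N, `|y|%N; rewrite !mem_iota /len /bot /top.
  by split; [lia|lia|congr pair; lia].
- have -> : size s = (\sum_(0 <= x < a.+1) len x)%N.
    rewrite size_allpairs_dep sumnE big_map /index_iota subn0.
    by apply: eq_bigr => x _; rewrite size_iota.
  (* By the cut inequalities at most [b] points are removed for each [x], so no subtraction in [top]
     or [len] truncates, and kept and removed points add up to [b.+1]. *)
  have rows : (\sum_(0 <= x < a.+1) (len x + ((c0 - x) + (c3 - x) +
      (x - (a - c1)) + (x - (a - c2)))) = a.+1 * b.+1)%N.
    transitivity (\sum_(0 <= x < a.+1) b.+1)%N; last first.
      by rewrite sum_nat_const_nat subn0.
    rewrite big_nat_cond [RHS]big_nat_cond; apply: eq_bigr => x.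
    by rewrite /len /bot /top => /andP[/andP[_ ltx] _]; lia.
  move: rows; rewrite !big_split /=.
  have := @sum_subn_const a.+1 c0; have := @sum_subn_const a.+1 c3.
  have := @sum_const_subn a.+1 (a - c1); have := @sum_const_subn a.+1 (a - c2).
  have -> : (a.+1 - (a - c1) = c1.+1)%N by lia.
  have -> : (a.+1 - (a - c2) = c2.+1)%N by lia.
  rewrite /=.
  move: (\sum_(_ <= _ < _) _)%N => s1 h1.
  move: (\sum_(_ <= _ < _) _)%N h1 => s2 h1 h2.
  move: (\sum_(_ <= _ < _) _)%N h1 h2 => s3 h1 h2 h3.
  move: (\sum_(_ <= _ < _) _)%N h1 h2 h3 => s4 h1 h2 h3 h4.
  move: (\sum_(_ <= _ < _) _)%N => s5 h5.
  have := h1 _; have := h2 _; have := h3 _; have := h4 _.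
  move=> /(_ ltac:(lia)) e4 /(_ ltac:(lia)) e3.
  move=> /(_ ltac:(lia)) e2 /(_ ltac:(lia)) e1.
  lia.
Qed.

(** * Optimal parameters *)

(* [h] is the slack of the sum of the four inequalities of
   [octagon_diameter_le]. *)
Lemma octagon_deficit (d a b c0 c1 c2 c3 : int) :
  let w := a + b in
  let h := c0 + c1 + c2 + c3 - (3 * w - 4 * d) in
  28 * (2 * (a + 1) * (b + 1) -
    (c0 * (c0 + 1) + c1 * (c1 + 1) + c2 * (c2 + 1) + c3 * (c3 + 1))) =
  4 * (8 * d * d + 16 * d + 15) -
   ((7 * w - 12 * d + 2) * (7 * w - 12 * d + 2) + 14 * ((a - b) * (a - b))
    + 7 * ((c0 + c2 - c1 - c3) * (c0 + c2 - c1 - c3))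
    + 14 * ((c0 - c2) * (c0 - c2) + (c1 - c3) * (c1 - c3))
    + 7 * (h * (2 * (3 * w - 4 * d) + h + 4))).
Proof. by move=> w h; rewrite /h /w; ring. Qed.

Lemma int_sqr_ge0 (x : int) : 0 <= x * x.
Proof. by rewrite -expr2 sqr_ge0. Qed.

Lemma int_sqr_le (x k : int) : `|x| <= k -> x * x <= k * k.
Proof.
by move=> le_k; rewrite -[x * x]ger0_norm ?int_sqr_ge0 // normrM ler_pM.
Qed.

(** A slack [h >= 2] alone loses at least [7 * 2 * 6]. If [h = 1], the loss [7 * (2 * k + 5)] forces
    [k = 0]; then [3 * w = 4 * d] gives [w >= 4], and the square adds at least 36 to 35. *)
Lemma slack_eq0 (d w h : int) : 1 <= d -> 0 <= 3 * w - 4 * d -> 0 <= h ->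
  (7 * w - 12 * d + 2) * (7 * w - 12 * d + 2) +
    7 * (h * (2 * (3 * w - 4 * d) + h + 4)) <= 44 -> h = 0.
Proof.
move=> d_gt0 m0_ge0 h_ge0 le44.
have [k ek] : exists k, k = 3 * w - 4 * d by eexists.
have sqE := int_sqr_ge0 (7 * w - 12 * d + 2).
have h_lt2 : h < 2.
  rewrite -ek in m0_ge0 le44; have [//|h_ge2] := ltP h 2.
  have : 2 * 6 <= h * (2 * k + h + 4).
    by apply: ler_pM => //; lia.
  by lia.
have [h1|] := eqVneq h 1; last by lia.
have k0 : k = 0 by move: le44 sqE; rewrite h1 -ek => *; lia.
have w4 : 4 <= w by lia.
move: le44; rewrite h1 -ek k0 (_ : 7 * w - 12 * d + 2 = 2 - 2 * w); last lia.
have : 6 * 6 <= (2 * w - 2) * (2 * w - 2) by apply: ler_pM => //; lia.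
by lia.
Qed.

(** Here [t] stands for [(a - b)^2] and [m] for the sum of the cuts, so the slack is
    [m - (3 * w - 4 * d)]. *)
Lemma domino_case (d w t m : int) : 1 <= d -> 3 * w - 4 * d < 0 -> 0 <= w ->
  0 <= m -> (w = 1 -> 1 <= t) -> 0 <= t ->
  (7 * w - 12 * d + 2) * (7 * w - 12 * d + 2) + 14 * t +
    7 * ((m - (3 * w - 4 * d)) * (m + (3 * w - 4 * d) + 4)) <= 44 ->
  [/\ d = 1, w = 1 & m = 0].
Proof.
move=> d_gt0 m0_lt0 w_ge0 m_ge0 t1 t_ge0.
have [k ek] : exists k, 3 * w - 4 * d = - k by exists (- (3 * w - 4 * d)); lia.
have [E eE] : exists E, 7 * w - 12 * d + 2 = E by eexists.
rewrite ek eE => le44.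
have sqE : 9 * (E * E) = (8 * d + 7 * k - 6) * (8 * d + 7 * k - 6).
  have e3 : 3 * E = - (8 * d + 7 * k - 6) by lia.
  have -> : 9 * (E * E) = (3 * E) * (3 * E) by ring.
  by rewrite e3; ring.
have sqm := int_sqr_ge0 m.
have dk : k * k <= 4 * d * k by apply: ler_wpM2r; lia.
have dk_ge0 : 0 <= (d - 1) * k by apply: mulr_ge0; lia.
(* Nine times the loss bound 44, with [w] eliminated. The term [- 14 * (k * k)] is absorbed through
   [k <= 4 * d], which is [w >= 0]. *)
have le396 : 64 * (d * d) - 96 * d + 36 + 56 * (d * k) + 168 * k <= 396 by lia.
have d_lt3 : d < 3.
  have [//|d_ge3] := ltP d 3; exfalso.
  have : 0 <= (d - 3) * d by apply: mulr_ge0; lia.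
  by lia.
have [d1|d1] := eqVneq d 1; last first.
  have d2 : d = 2 by lia.
  (* Only [k = 1] satisfies the bound, and [3 * w = 7] has no integer solution. *)
  by move: le396 ek; rewrite d2; lia.
have w1 : w = 1 by move: le396 ek; rewrite d1; lia.
have k1 : k = 1 by lia.
have E3 : E = -3 by lia.
(* The loss is now [9 + 14 * t + 7 * (m + 1) * (m + 3)], which equals 44 at [t = 1], [m = 0]: the
   domino just fits. *)
have := t1 w1; split=> //; move: le44; rewrite k1 E3; lia.
Qed.

Lemma optimal_octagon (d a b c0 c1 c2 c3 : int) :
  1 <= d -> [/\ 0 <= c0, 0 <= c1, 0 <= c2 & 0 <= c3] -> 0 <= a -> 0 <= b ->
  [/\ 2 * a + b <= c0 + c3 + 2 * d, 2 * a + b <= c1 + c2 + 2 * d,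
      a + 2 * b <= c0 + c1 + 2 * d & a + 2 * b <= c2 + c3 + 2 * d] ->
  8 * d * d + 16 * d + 4 <= 7 * (2 * (a + 1) * (b + 1) -
    (c0 * (c0 + 1) + c1 * (c1 + 1) + c2 * (c2 + 1) + c3 * (c3 + 1))) ->
  [/\ [/\ a = b, c0 = c2 & c1 = c3], c0 + c1 = 3 * a - 2 * d,
      `|7 * a - 6 * d + 1| <= 3 & `|c0 - c1| <= 1] \/
  [/\ d = 1, a + b = 1 & c0 + c1 + c2 + c3 = 0].
Proof.
move=> d_gt0 [g0 g1 g2 g3] a_ge0 b_ge0 [h1 h2 h3 h4].
have := octagon_deficit d a b c0 c1 c2 c3; rewrite /=.
move: (_ * (a + 1) * (b + 1) - _) => N eN leN.
have : 4 * (8 * d * d + 16 * d + 4) <= 28 * N by lia.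
rewrite {}eN {leN N}.
have [w ew] : exists w, w = a + b by eexists.
have [h eh] : exists h, h = c0 + c1 + c2 + c3 - (3 * w - 4 * d) by eexists.
rewrite -ew -eh.
(* The first two diameter inequalities add up to [a - b <= h], the last two to [b - a <= h]. *)
have h_ge0 : `|a - b| <= h by lia.
have := int_sqr_ge0 (a - b); have := int_sqr_ge0 (7 * w - 12 * d + 2).
have := int_sqr_ge0 (c0 + c2 - c1 - c3).
have := int_sqr_ge0 (c0 - c2); have := int_sqr_ge0 (c1 - c3).
have [Q eQ] : exists Q, Q = (c0 + c2 - c1 - c3) * (c0 + c2 - c1 - c3).
  by eexists.
have [P eP] : exists P, P = (a - b) * (a - b) by eexists.
have [F eF] : exists F, F = (7 * w - 12 * d + 2) * (7 * w - 12 * d + 2).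
  by eexists.
rewrite -eQ -eP -eF => q1 q2 Q_ge0 F_ge0 P_ge0 le0.
have le44 : F + 14 * P + 7 * Q + 7 * (h * (2 * (3 * w - 4 * d) + h + 4)) <= 44.
  by lia.
have [m0_ge0|m0_lt0] := leP 0 (3 * w - 4 * d).
  have h0 : h = 0.
    by apply: (@slack_eq0 d w) => //; [lia | rewrite -eF; lia].
  move: le44; rewrite h0 mul0r => le44.
  (* Zero slack turns all four diameter inequalities into equalities, so opposite cuts agree. *)
  have eab : a = b by lia.
  have e02 : c0 = c2 by lia.
  have e13 : c1 = c3 by lia.
  left; split; [by []|lia| |].
  (* From [4 * e^2 <= 44] follows [|e| <= 3]; for the cuts below, [28 * e^2 <= 44] gives
     [|e| <= 1]. *)
  - rewrite (_ : 7 * w - 12 * d + 2 = 2 * (7 * a - 6 * d + 1)) in eF; last lia.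
    by move: (7 * a - 6 * d + 1) eF => e eF; nia.
  - rewrite (_ : c0 + c2 - c1 - c3 = 2 * (c0 - c1)) in eQ; last lia.
    by move: (c0 - c1) eQ => e eQ; nia.
right.
have [-> w1 m0] : [/\ d = 1, w = 1 & c0 + c1 + c2 + c3 = 0]; last first.
  by split=> //; lia.
apply: (@domino_case d w P) => //; [by lia|by lia| |].
- move=> w1; rewrite eP.
  (* An odd [a + b] excludes [a = b]. *)
  have : 1 <= `|a - b| by lia.
  by clear; move: (a - b) => e; nia.
- move: le44; rewrite -eF (_ : h = c0 + c1 + c2 + c3 - (3 * w - 4 * d)) //.
  by lia.
Qed.

Lemma symmetric_octagon_size (d a c0 c1 : int) :
  c0 + c1 = 3 * a - 2 * d ->
  7 * (2 * (a + 1) * (a + 1) -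
    (c0 * (c0 + 1) + c1 * (c1 + 1) + c0 * (c0 + 1) + c1 * (c1 + 1))) =
  8 * d * d + 16 * d + 15 -
    ((7 * a - 6 * d + 1) * (7 * a - 6 * d + 1) + 7 * ((c0 - c1) * (c0 - c1))).
Proof.
move=> hc; have e1 : c1 = 3 * a - 2 * d - c0 by lia.
by rewrite e1; ring.
Qed.

(** * Cardinalities, quarter turns and the explicit parameters *)

Lemma sub_card_le_eq (T : choiceType) (A B : set T) :
  finite_set B -> A `<=` B -> B #<= A -> A = B.
Proof.
move=> finB sAB leBA; have finA := sub_finite_set sAB finB.
apply: fset_set_inj => //; apply/eqP; rewrite eqEfcard; apply/andP; split.
  by rewrite -fset_set_sub.
apply: leq_card_fset_set => //.
have /card_eq_fsetP : #|` fset_set B| = #|` fset_set B| by [].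
rewrite fset_setK // => /card_esym BI; by rewrite (card_le_eql BI).
Qed.

Lemma translate_inj t : injective (fun z : int * int => z + t).
Proof. exact: addIr. Qed.

Lemma card_octagon (a b c0 c1 c2 c3 : int) (t : int * int) :
  octagon_cuts a b c0 c1 c2 c3 ->
  exists n : nat, [set z + t | z in octagon a b c0 c1 c2 c3] #= `I_n /\
    2 * n%:Z = 2 * (a + 1) * (b + 1) -
      (c0 * (c0 + 1) + c1 * (c1 + 1) + c2 * (c2 + 1) + c3 * (c3 + 1)).
Proof.
case: a b c0 c1 c2 c3 => [a|?] [b|?] [c0|?] [c1|?] [c2|?] [c3|?];
  try by move=> cuts; exfalso; move: cuts => [[]]; lia.
move=> /octagon_enum[s [us -> szs]]; exists (size s); split; last by lia.
apply: card_eq_trans (inj_card_eq (in2W (@translate_inj t))) _.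
rewrite (_ : [set` s] = [set` [fset x in s]%fset]); last first.
  by apply/seteqP; split=> x /=; rewrite inE.
by apply/card_eq_fsetP; rewrite card_fseq undup_id.
Qed.

(** A quarter turn permutes the four cuts cyclically, and the shift by [(b, 0)] moves the bounding
    box back to the origin. For a symmetric octagon this exchanges [c0] and [c1]. *)
Lemma octagon_rot90 (a b c0 c1 c2 c3 : int) :
  octagon b a c3 c0 c1 c2 =
  [set rot90 z + (b, 0) | z in octagon a b c0 c1 c2 c3].
Proof.
apply/seteqP; split=> [[x y]|_ [[x y] + <-]]; rewrite /octagon /rot90 /=.
  move=> [/andP[? ?] /andP[? ?] /andP[? ?] /andP[? ?]].
  exists (y, b - x); first by split; apply/andP; split; rewrite /=; lia.
  by congr pair; rewrite /=; lia.
move=> -[/andP[? ?] /andP[? ?] /andP[? ?] /andP[? ?]].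
by split; apply/andP; split; lia.
Qed.

Lemma octagon_rot90_translate (a b c0 c1 c2 c3 : int) t :
  same_up_to_rot90_translation [set z + t | z in octagon b a c3 c0 c1 c2]
    (octagon a b c0 c1 c2 c3).
Proof.
exists ((b, 0) + t); right; rewrite octagon_rot90 image_comp.
by apply: eq_imagel => z _ /=; rewrite addrA.
Qed.

Lemma rat_div7 (z : int) (d p q q' : nat) :
  7 * z = p%:Z * d%:Z + q%:Z - q'%:Z ->
  z%:~R = (p%:R * d%:R + q%:R - q'%:R) / 7 :> rat.
Proof.
move=> e; have : (7 * z)%:~R = (p%:Z * d%:Z + q%:Z - q'%:Z)%:~R :> rat.
  by rewrite e.
rewrite rmorphB rmorphD /= !intrM -!pmulrn => <-.
by rewrite mulrAC divff ?mul1r.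
Qed.

(** The seven integers of absolute value at most 3 represent each residue mod 7 once, so [d]
    determines [a]; the parity of [c0 + c1] then determines both cuts. *)
Lemma optimal_parametersP d (a c0 c1 : int) :
  `|7 * a - 6 * d%:Z + 1| <= 3 -> c0 + c1 = 3 * a - 2 * d%:Z ->
  0 <= c1 - c0 <= 1 -> optimal_parameters d a c0 c1.
Proof.
move=> ha hc hcc; rewrite /optimal_parameters.
have div7 (z : int) (p : nat) : 7 * z = p%:Z * d%:Z ->
    z%:~R = p%:R * d%:R / 7 :> rat.
  by move=> e; rewrite (@rat_div7 z d p 0 0) ?addr0 ?subr0 //; lia.
have div7D (z : int) (p q : nat) : 7 * z = p%:Z * d%:Z + q%:Z ->
    z%:~R = (p%:R * d%:R + q%:R) / 7 :> rat.
  by move=> e; rewrite (@rat_div7 z d p q 0) ?subr0 //; lia.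
have div7B (z : int) (p q : nat) : 7 * z = p%:Z * d%:Z - q%:Z ->
    z%:~R = (p%:R * d%:R - q%:R) / 7 :> rat.
  by move=> e; rewrite (@rat_div7 z d p 0 q) ?addr0 //; lia.
have : (d %% 7 < 7)%N by rewrite ltn_mod.
have := divn_eq d 7; move: (d %/ 7)%N (d %% 7)%N => k r ed.
case: r ed => [|[|[|[|[|[|[|r]]]]]]] // ed _; split.
all: first [apply: div7; lia | apply: div7D; lia | apply: div7B; lia
  | apply: (div7D _ 6%N 1%N); lia | apply: (div7B _ 6%N 1%N); lia
  | apply: (div7B _ 2%N 1%N); lia].
Qed.

Lemma exists_parameters d : exists a c0 c1 : int,
  [/\ `|7 * a - 6 * d%:Z + 1| <= 3, c0 + c1 = 3 * a - 2 * d%:Z &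
      0 <= c1 - c0 <= 1].
Proof.
have [a ha] : exists a : int, `|7 * a - 6 * d%:Z + 1| <= 3.
  (* This is [(6 * d - 1) / 7] rounded to the nearest integer. *)
  by exists ((6 * d%:Z + 2) %/ 7)%Z; lia.
have [c0 hc] : exists c0 : int, 0 <= 3 * a - 2 * d%:Z - 2 * c0 <= 1.
  by exists ((3 * a - 2 * d%:Z) %/ 2)%Z; lia.
by exists a, c0, (3 * a - 2 * d%:Z - c0); split; lia.
Qed.

Lemma ceil_div7 (m n : int) : m <= 7 * n < m + 7 ->
  Num.ceil (m%:~R / 7 : rat) = n.
Proof.
move=> /andP[mn nm]; apply: ceil_def; apply/andP; split.
  by rewrite ltr_pdivlMr // -[7]/(7%:~R) -intrM ltr_int; lia.
by rewrite ler_pdivrMr // -[7]/(7%:~R) -intrM ler_int; lia.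
Qed.

Theorem theorem20 (d : nat) (hd : (1 <= d)%N) (A : set (int * int))
  (hA : optimal_anticode d A) :
  (exists2 n : nat, A #= `I_n &
     n%:Z = Num.ceil ((4 * d%:R ^+ 2 + 8 * d%:R + 2) / 7 : rat)) /\
  ((exists a b c0 c1 c2 c3 : int,
      [/\ [/\ a = b, c0 = c2 & c1 = c3],
          optimal_parameters d a c0 c1 &
          same_up_to_rot90_translation A (octagon a b c0 c1 c2 c3)]) \/
   (d = 1%N /\ same_up_to_rot90_translation A (octagon 1 0 0 0 0 0))).
Proof.
have [anti opt] := hA.
have [a' [c0' [c1' [ha' hc' hcc']]]] := exists_parameters d.
have diam' : octagon_diameter_le d a' a' c0' c1' c0' c1' by split; lia.
have cuts' : octagon_cuts a' a' c0' c1' c0' c1' by split; [split|..]; lia.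
have [n' [card' en']] := card_octagon 0 cuts'.
have le' := opt _ (@anticode_translate d _ 0 (octagon_anticode diam')).
(* The loss in [symmetric_octagon_size] is at most 11, that is [9 + 0] for equal cuts and [4 + 7]
   otherwise: unequal cuts make [a'] odd, so [7 * a' - 6 * d + 1] is even. *)
have large' : 8 * d%:Z * d%:Z + 16 * d%:Z + 4 <= 14 * n'%:Z.
  have := symmetric_octagon_size hc'; rewrite -en' => sz.
  have [c01|c01] : c0' - c1' = 0 \/ c0' - c1' = - 1 by lia.
    move: sz; rewrite c01; move: (7 * a' - 6 * d%:Z + 1) ha' => e he.
    have := int_sqr_le he.
    by lia.
  have : `|7 * a' - 6 * d%:Z + 1| <= 2 by lia.
  move: sz; rewrite c01; move: (7 * a' - 6 * d%:Z + 1) => e sz he.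
  have := int_sqr_le he.
  by lia.
have A0 : A !=set0.
  apply/set0P/eqP => A0; move: le'; rewrite A0 card_le0 => /eqP B0.
  have : [set z + 0 | z in octagon a' a' c0' c1' c0' c1'] ((c0', 0) + 0).
    exists (c0', 0) => //; have [[? ? _ _] ? _ _ _] := cuts'.
    by rewrite /octagon /=; split; lia.
  by rewrite B0.
have [t [a [b [c0 [c1 [c2 [c3 [diam cuts sub]]]]]]]] :=
  anticode_sub_octagon anti A0.
have [n [cardB en]] := card_octagon t cuts.
have finB : finite_set [set z + t | z in octagon a b c0 c1 c2 c3].
  by apply/finite_setP; exists n.
have leBA := opt _ (@anticode_translate d _ t (octagon_anticode diam)).
(* The enclosing octagon is itself an anticode, so the optimal [A] fills it. *)
have eA := sub_card_le_eq finB sub leBA.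
have le_n : (n' <= n)%N.
  by rewrite -card_le_II -(card_le_eql card') -(card_le_eqr cardB) -eA.
have [[c0_ge0 c1_ge0 c2_ge0 c3_ge0] c01 c12 c23 c03] := cuts.
have large : 8 * d%:Z * d%:Z + 16 * d%:Z + 4 <= 7 * (2 * n%:Z) by lia.
have hopt : [/\ [/\ a = b, c0 = c2 & c1 = c3], c0 + c1 = 3 * a - 2 * d%:Z,
    `|7 * a - 6 * d%:Z + 1| <= 3 & `|c0 - c1| <= 1] \/
    [/\ d%:Z = 1, a + b = 1 & c0 + c1 + c2 + c3 = 0].
  by apply: optimal_octagon => //; [lia|lia|rewrite -en].
(* With [m = 4 * d^2 + 8 * d + 2], this and [large] give [2 * m <= 14 * n <= 2 * m + 11], so [n] is
   the ceiling of [m / 7]. *)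
have le_n14 : 14 * n%:Z <= 8 * d%:Z * d%:Z + 16 * d%:Z + 15.
  case: hopt => [[[eab e02 e13] ec _ _]|[ed ew em]].
    have := symmetric_octagon_size ec; move: en; rewrite -eab -e02 -e13 => <- e.
    have := int_sqr_ge0 (7 * a - 6 * d%:Z + 1); have := int_sqr_ge0 (c0 - c1).
    by lia.
  rewrite ed; move: en.
  have [-> [-> [-> ->]]] : c0 = 0 /\ c1 = 0 /\ c2 = 0 /\ c3 = 0 by lia.
  have -> : b = 1 - a by lia.
  have [->|->] : a = 0 \/ a = 1 by lia.
    by lia.
  by lia.
split.
  exists n; first by rewrite eA.
  have -> : (4 * d%:R ^+ 2 + 8 * d%:R + 2 : rat) =
      (4 * d%:Z * d%:Z + 8 * d%:Z + 2)%:~R.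
    by rewrite !rmorphD /= !intrM -!pmulrn expr2 mulrA.
  by rewrite (@ceil_div7 _ n%:Z) //; apply/andP; split; lia.
rewrite {}eA {sub leBA finB cardB en}.
case: hopt => [[[eab e02 e13] ec ha hc]|[ed ew em]].
  subst b c2 c3; left.
  (* The stated parameters have [c0 <= c1]; a quarter turn handles the other order. *)
  have [le01|lt10] := leP c0 c1.
    exists a, a, c0, c1, c0, c1; split=> //.
      by apply: optimal_parametersP => //; lia.
    by exists t; left.
  exists a, a, c1, c0, c1, c0; split=> //.
    by apply: optimal_parametersP => //; lia.
  exact: octagon_rot90_translate.
right; split; first by lia.
have [-> [-> [-> ->]]] : c0 = 0 /\ c1 = 0 /\ c2 = 0 /\ c3 = 0 by lia.
have [b0|b0] := eqVneq b 0.
  have -> : a = 1 by lia.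
  by rewrite b0; exists t; left.
have -> : a = 0 by lia.
have -> : b = 1 by lia.
exact: octagon_rot90_translate.
Qed.
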